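(* Let $(X,d)$ be a locally connected metric space and $f:X\to X$ a continuous map. Then $(X,f)$ is thickly syndetically sensitive if and only if it is thickly syndetically strongly $\beta$-$n$-sensitive, i.e. if and only if it is thickly syndetically $\beta$-$n$-sensitive for every $n\in\mathbb{N}$ with $n\geq2$ and every $\beta\in\mathbb{N}^n$.
   Context: $\mathbb{N}=\{1,2,3,\dots\}$. A set $A\subseteq\mathbb{N}$ is syndetic if there is a positive integer $M$ with $\{i,i+1,\dots,i+M\}\cap A\neq\emptyset$ for every $i\in\mathbb{N}$; it is thickly syndetic if for every $l\in\mathbb{N}$ the set $\{m\in\mathbb{N}: m+j\in A \text{ for } 0\leq j\leq l\}$ is syndetic. - $(X,f)$ is thickly syndetically sensitive if there is $\delta>0$ such that for every nonempty open $U\subseteq X$ the set $\{k\in\mathbb{N}:\exists x,y\in U \text{ with } d(f^k(x),f^k(y))>\delta\}$ is thickly syndetic. - For $n\ge2$ and $\beta=(m_1,\dots,m_n)\in\mathbb{N}^n$, $(X,f)$ is thickly syndetically $\beta$-$n$-sensitive if there is $\delta>0$ (allowed to depend on $n$ and $\beta$) such that for every nonempty open $U\subseteq X$ the set $\{k\in\mathbb{N}:\exists x_1,\dots,x_n\in U \text{ with } \min_{1\leq i<j\leq n}d(f^{m_ik}(x_i),f^{m_jk}(x_j))>\delta\}$ is thickly syndetic. *)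

(* Defs.v *)
From mathcomp Require Import all_boot all_order all_algebra.
From mathcomp Require Import all_classical reals topology.

Set Implicit Arguments.
Unset Strict Implicit.
Unset Printing Implicit Defensive.

Import Order.TTheory GRing.Theory Num.Theory.

Local Open Scope classical_set_scope.
Local Open Scope ring_scope.

(* The natural numbers of the source start at 1: sets of natural numbers are
   rendered as [A : set nat], and every index ranging over them carries an
   explicit positivity condition. *)

Definition syndetic (A : set nat) : Prop :=
  exists2 M : nat, (0 < M)%N &
    forall i : nat, (0 < i)%N -> [set j | (i <= j <= i + M)%N] `&` A !=set0.

Definition thickly_syndetic (A : set nat) : Prop :=
  forall l : nat, (0 < l)%N ->
    syndetic [set m | (0 < m)%N /\ forall j : nat, (j <= l)%N -> A (m + j)%N].

Definition locally_connected (X : topologicalType) : Prop :=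
  forall (x : X) (U : set X), open U -> U x ->
    exists V : set X, [/\ open V, connected V, V x & V `<=` U].

Definition thickly_syndetically_sensitive (R : realType) (X : metricType R)
    (f : X -> X) : Prop :=
  exists2 delta : R, 0 < delta &
    forall U : set X, open U -> U !=set0 ->
      thickly_syndetic [set k | (0 < k)%N /\
        exists x y : X, [/\ U x, U y &
          delta < mdist (iter k f x) (iter k f y)]].

(* Membership of [k] says that the minimum, over the pairs [i < j], of the
   distances exceeds [delta]. *)
Definition thickly_syndetically_beta_sensitive (R : realType)
    (X : metricType R) (f : X -> X) (n : nat) (beta : 'I_n -> nat) : Prop :=
  exists2 delta : R, 0 < delta &
    forall U : set X, open U -> U !=set0 ->
      thickly_syndetic [set k | (0 < k)%N /\
        exists x : 'I_n -> X, (forall i, U (x i)) /\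
          forall i j : 'I_n, (i < j)%N ->
            delta < mdist (iter (beta i * k)%N f (x i))
                          (iter (beta j * k)%N f (x j))].

Definition thickly_syndetically_strongly_sensitive (R : realType)
    (X : metricType R) (f : X -> X) : Prop :=
  forall (n : nat) (beta : 'I_n -> nat),
    (2 <= n)%N -> (forall i, (0 < beta i)%N) ->
    thickly_syndetically_beta_sensitive f beta.

(* Main.v *)
Require Import Defs.
From mathcomp Require Import all_boot all_order all_algebra.
From mathcomp Require Import all_classical reals topology.
From mathcomp Require Import pseudometric_normed_Zmodule normed_module zify lra.

(** For the nontrivial direction, replace [U] by a connected open subset. When
    every [beta i * k] is a sensitive time, each image [f^(beta i * k)(U)] is
    connected of diameter more than [delta], so the distance to a suitable
    point of it takes all values in [0, delta]; one of these values is far from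
    the distances to the finitely many points chosen so far, which allows the
    [x i] to be chosen one after the other. Such [k] form a thickly syndetic
    set, since thickly syndetic sets are stable under finite intersection and
    under preimage by multiplication by a positive integer. *)

Import Order.TTheory GRing.Theory Num.Theory.
Import numFieldNormedType.Exports.

Local Open Scope classical_set_scope.
Local Open Scope ring_scope.

Lemma thickly_syndetic_sub (A B : set nat) :
  A `<=` B -> thickly_syndetic A -> thickly_syndetic B.
Proof.
move=> AB tA l l0; have [M M0 hM] := tA l l0; exists M => // i i0.
have [m [im [m0 mA]]] := hM i i0.
by exists m; split => //; split => // j jl; exact/AB/mA.
Qed.

Lemma thickly_syndeticT : thickly_syndetic setT.
Proof.
by move=> l l0; exists 1%N => // i i0; exists i; split => //=; rewrite leqnn leq_addr.
Qed.

(** If [M] bounds the gaps between starts of [B]-blocks of length [l], then an [A]-block of length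
    [l + M] starting at [s] has such a start [t] in [[s, s + M]], and the whole block from [t] to
    [t + l] still lies in the [A]-block. *)
Lemma thickly_syndeticI (A B : set nat) :
  thickly_syndetic A -> thickly_syndetic B -> thickly_syndetic (A `&` B).
Proof.
move=> tA tB l l0; have [M M0 hM] := tB l l0.
have [N N0 hN] : syndetic [set m | (0 < m)%N /\
    forall j, (j <= l + M)%N -> A (m + j)%N] by apply: tA; lia.
exists (N + M)%N => [|i i0]; first lia.
have [s [/= /andP[si sN] [s0 sA]]] := hN i i0.
have [t [/= /andP[ts tM] [t0 tB']]] := hM s s0.
exists t; split; first by apply/andP; split; lia.
split => // j jl; split; last exact: tB'.
have -> : (t + j = s + (t - s + j))%N by lia.
by apply: sA; lia.
Qed.

Lemma thickly_syndetic_forall (T : finType) (A : T -> set nat) :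
  (forall i, thickly_syndetic (A i)) ->
  thickly_syndetic [set k | forall i, A i k].
Proof.
move=> tA; suff H (s : seq T) : thickly_syndetic [set k | forall i, i \in s -> A i k].
  by apply: thickly_syndetic_sub (H (enum T)) => k h i; apply: h; rewrite mem_enum.
elim: s => [|a s IH]; first exact: thickly_syndetic_sub thickly_syndeticT.
apply: thickly_syndetic_sub (thickly_syndeticI _ _ (tA a) IH) => k [/= ak sk] i.
by rewrite inE => /predU1P[->//|]; exact: sk.
Qed.

(** A block of [A] of length [m * l + m] starting at [s] contains [l + 1] consecutive multiples of
    [m], beginning with the first one strictly above [s], namely [m * (s %/ m).+1]. *)
Lemma thickly_syndetic_muln (m : nat) (A : set nat) :
  (0 < m)%N -> thickly_syndetic A -> thickly_syndetic [set k | A (m * k)%N].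
Proof.
move=> m0 tA l l0; have [M M0 hM] : syndetic [set s | (0 < s)%N /\
  forall j, (j <= m * l + m)%N -> A (s + j)%N] by apply: tA; lia.
exists M.+1 => // i i0.
have [|s [/= /andP[si sM] [s0 sA]]] := hM (m * i)%N; first by rewrite muln_gt0 m0.
have sE := divn_eq s m; have sm := ltn_pmod s m0.
have qi : (i <= s %/ m)%N by rewrite leq_divRL // mulnC.
have qM : (s %/ m <= i + M)%N.
  rewrite -(leq_pmul2r m0); nia.
exists (s %/ m).+1; split; first by apply/andP; split; lia.
split => // j jl /=.
have -> : (m * ((s %/ m).+1 + j) = s + (m - s %% m + m * j))%N by nia.
by apply: sA; nia.
Qed.

(* The values [3 * e * k] for [k <= size s] are so spread out that each element
   of [s] is within [e] of at most one of them. *)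
Lemma exists_far_real (R : realFieldType) (e D : R) (s : seq R) :
  0 < e -> 3 * e * (size s)%:R <= D ->
  exists2 t : R, 0 <= t <= D & forall r, r \in s -> e < `|r - t|.
Proof.
move=> e0 eD.
case: (pselect (exists k : 'I_(size s).+1,
    forall r, r \in s -> e < `|r - 3 * e * k%:R|)) => [[k hk]|nk].
  exists (3 * e * k%:R) => //.
  have kn : k%:R <= (size s)%:R :> R by rewrite ler_nat -ltnS.
  have k0 : 0 <= k%:R :> R by [].
  by apply/andP; split; nra.
have /choice[g gP] : forall k : 'I_(size s).+1,
    exists r, r \in s /\ `|r - 3 * e * k%:R| <= e.
  move=> k; apply: contrapT => h; apply: nk; exists k => r rs.
  by rewrite ltNge; apply/negP => h'; apply: h; exists r.
have g_inj : injective g.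
  move=> k l gkl; apply: val_inj; have [_] := gP k; have [_] := gP l.
  rewrite gkl !ler_norml => /andP[? ?] /andP[? ?].
  case: (ltngtP k l) => // H; exfalso; move: H;
    by rewrite -(ler_nat R) -natr1 -(ler_pM2l e0); lra.
have /uniq_leq_size : uniq (codom g) by rewrite map_inj_uniq // enum_uniq.
move=> /(_ s); rewrite size_codom card_ord ltnn => H.
by case: (notF (H _)) => _ /codomP[k ->]; case: (gP k).
Qed.

Lemma ler_dist_mdist (R : realType) (X : metricType R) (p x y : X) :
  `|mdist p x - mdist p y| <= mdist x y.
Proof.
rewrite ler_norml; apply/andP; split.
  by have := metric_triangle p x y; lra.
by have := metric_triangle p y x; rewrite (metric_sym y x); lra.
Qed.

Lemma mdist_continuous (R : realType) (X : metricType R) (p : X) :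
  continuous (mdist p : X -> R).
Proof.
move=> x; apply/cvgrPdist_le => e e0; rewrite near_simpl.
have : \forall y \near x, ball x e y by exact: nbhsx_ballx.
apply: filterS => y; rewrite ballEmdist /= => /ltW.
exact/le_trans/ler_dist_mdist.
Qed.

(** The map [mdist p] sends [C] onto an interval containing [0] and [mdist p q], so some [z] in [C]
    lies at a distance from [p] that is far from all [mdist p y]. Since [mdist p] is 1-Lipschitz,
    [z] itself is then far from every [y]. *)
Lemma connected_far_point (R : realType) (X : metricType R) (C : set X)
    (p q : X) (e : R) (s : seq X) :
  connected C -> C p -> C q -> 0 < e -> 3 * e * (size s)%:R <= mdist p q ->
  exists2 z, C z & forall y, y \in s -> e < mdist y z.
Proof.
move=> cC Cp Cq e0 epq.
have [|t /andP[t0 tpq] tfar] :=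
  @exists_far_real R e (mdist p q) (map (mdist p) s) e0.
  by rewrite size_map.
have /connected_intervalP : connected [set mdist p x | x in C].
  apply: connected_continuous_connected => //.
  exact/continuous_subspaceT/mdist_continuous.
case/(_ 0 (mdist p q) _ _ t); first by exists p => //; rewrite mdistxx.
- by exists q.
- by rewrite t0.
move=> z Cz zt; exists z => // y ys.
by apply: lt_le_trans (ler_dist_mdist _ _ p _ _); rewrite zt; exact/tfar/map_f.
Qed.

(** Greedy choice by induction on the number [m] of indices settled. Partial tuples are avoided by
    keeping a total [x], whose values at indices [>= m] are arbitrary; hence the hypothesis asks for
    [Q j i] at all [j], not only at [j < i]. *)
Lemma ord_successive_choice (T : Type) (n : nat) (P : 'I_n -> T -> Prop)
    (Q : 'I_n -> 'I_n -> T -> T -> Prop) (x0 : 'I_n -> T) :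
  (forall i (x : 'I_n -> T), exists2 z, P i z & forall j, Q j i (x j) z) ->
  exists x : 'I_n -> T, (forall i, P i (x i)) /\
    forall i j : 'I_n, (i < j)%N -> Q i j (x i) (x j).
Proof.
move=> H; suff h m : (m <= n)%N -> exists x : 'I_n -> T, forall j : 'I_n,
    (j < m)%N -> P j (x j) /\ forall i : 'I_n, (i < j)%N -> Q i j (x i) (x j).
  have [x xP] := h n (leqnn n); exists x.
  by split => [i|i j]; [case: (xP i)|case: (xP j)] => // _; exact.
elim: m => [|m IH] mn; first by exists x0.
have [x xP] := IH (ltnW mn); pose o := Ordinal mn.
have [z Pz Qz] := H o x.
(* Only the value at index [m] is overwritten, so the relations among smaller indices survive. *)
exists (fun i => if i == o then z else x i) => j; rewrite ltnS leq_eqVlt.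
have neq_o (i : 'I_n) : (i < m)%N -> (i == o) = false.
  by move=> im; apply/negbTE; rewrite -val_eqE /= neq_ltn im.
case/predU1P => [jm|jm].
  have -> : j = o by apply: val_inj.
  by rewrite eqxx; split => // i /neq_o ->.
rewrite (neq_o j jm); have [Pj Qj] := xP j jm; split => // i ij.
by rewrite neq_o ?(ltn_trans ij) //; exact: Qj.
Qed.

Lemma continuous_iter (T : topologicalType) (f : T -> T) (k : nat) :
  continuous f -> continuous (iter k f).
Proof.
move=> cf; elim: k => [|k IH] x /=; first exact: cvg_id.
by apply: continuous_comp; [exact: IH | exact: cf].
Qed.

Theorem corollary2 (R : realType) (X : metricType R) (f : X -> X)
    (hX : locally_connected X) (hf : continuous f) :
  thickly_syndetically_sensitive f <->
  thickly_syndetically_strongly_sensitive f.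
Proof.
split; last first.
  (* Sensitivity is the case [n = 2], [beta = (1, 1)]. *)
  move=> /(_ 2%N (fun=> 1%N)) [] // d d0 dP; exists d => // U oU U0.
  apply: thickly_syndetic_sub (dP U oU U0) => k [k0 [x [Ux xP]]]; split => //.
  exists (x ord0), (x ord_max); split => //.
  by have := xP ord0 ord_max isT; rewrite mul1n.
case=> d d0 dP n beta n2 beta0.
have n0 : 0 < n%:R :> R by rewrite ltr0n; lia.
(* Chosen so that [3 * e * n = d]: the interval [[0, d]] then has room to avoid [n] points by more
   than [e]. *)
pose e := d / (3 * n%:R).
have e0 : 0 < e by rewrite divr_gt0 ?mulr_gt0.
have eE : 3 * e * n%:R = d.
  by rewrite mulrAC mulrC divfK // mulf_neq0 // gt_eqF.
exists e => // U oU [u Uu].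
have [V [oV cV Vu VU]] := hX u U oU Uu.
have tk := @thickly_syndetic_forall _ _ (fun i =>
  thickly_syndetic_muln _ _ (beta0 i) (dP V oV (ex_intro _ u Vu))).
apply: thickly_syndetic_sub tk => k /= kP; split.
  by have [+ _] := kP (Ordinal n2); rewrite muln_gt0 => /andP[].
have [x [Vx xP]] : exists x : 'I_n -> X, (forall i, V (x i)) /\
    forall i j : 'I_n, (i < j)%N ->
      e < mdist (iter (beta i * k) f (x i)) (iter (beta j * k) f (x j)).
  apply: (@ord_successive_choice X n (fun=> V) (fun i j y z =>
    e < mdist (iter (beta i * k) f y) (iter (beta j * k) f z)) (fun=> u)) => i x.
  have [_ [a [b [Va Vb ab]]]] := kP i.
  (* The points to avoid are the images of all [n] current entries of [x], including those at index
     [i] and at indices not yet settled; the list thus always has size [n]. *)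
  have [|||||z [w Vw wz] zP] := @connected_far_point R X
      [set iter (beta i * k) f y | y in V] (iter (beta i * k) f a)
      (iter (beta i * k) f b) e
      [seq iter (beta j * k) f (x j) | j <- enum 'I_n].
  - apply: connected_continuous_connected => //.
    exact/continuous_subspaceT/continuous_iter.
  - by exists a.
  - by exists b.
  - by [].
  - by rewrite size_map size_enum_ord eE ltW.
  by exists w => // j; rewrite wz; apply: zP; apply: map_f; rewrite mem_enum.
by exists x; split => // i; exact/VU.
Qed.
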